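(* Every self-similar ultrametric Cantor set $(\Pi_\infty,\rho)$ is bi-Hölder embeddable in the real line; that is, there exist a map $\phi:\Pi_\infty\to\mathbb{R}$ and constants $c_-,c_+>0$ and exponents $a,b>0$ such that $$c_-\,\rho(x,y)^{a}\le|\phi(x)-\phi(y)|\le c_+\,\rho(x,y)^{b}\qquad\text{for all }x,y\in\Pi_\infty .$$
   Context: Stationary Bratteli diagram: given finite sets $\mathcal{V}$, $\mathcal{E}$ and maps $s,r:\mathcal{E}\to\mathcal{V}$ (source, range), it is the infinite oriented graph with vertex levels $V_0=\{\circ\}$ (root) and $V_n$ a copy of $\mathcal{V}$ for $n\ge1$, and edge levels $E_0$, consisting of exactly one edge from $\circ$ to each vertex of $V_1$, and, for $n\ge 1$, $E_n$ a copy of $\mathcal{E}$, where $e\in\mathcal{E}$ goes from the copy of $s(e)$ in $V_n$ to the copy of $r(e)$ in $V_{n+1}$. Paths: a finite path of length $|\gamma|=n$ is $\gamma=(e_0,\dots,e_{n-1})$ from the root to $V_n$ ($e_j\in E_j$, $r(e_j)=s(e_{j+1})$), including the empty path for $n=0$; $\Pi$ is the set of finite paths; $\Pi_\infty$ is the set of infinite paths, with the topology induced by the product of the discrete topologies on the $E_j$. For $x\ne y$ in $\Pi_\infty$, $x\wedge y\in\Pi$ is the longest common prefix. Self-similar ultrametric Cantor set: such a $\Pi_\infty$ which is a Cantor set (nonempty, compact, totally disconnected, no isolated points), with an ultrametric $\rho$ of the form $\rho(x,y)=a_{x\wedge y}\,\alpha^{|x\wedge y|}$ for $x\neq y$, $\rho(x,x)=0$,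 where $\alpha\in(0,1)$ (the parameter of $\rho$), $a_\gamma\in(0,\infty)$ for $\gamma\in\Pi$, $0<\inf_{\gamma\in\Pi}a_\gamma\le\sup_{\gamma\in\Pi}a_\gamma<\infty$, and the weight $\gamma\mapsto a_\gamma\alpha^{|\gamma|}$ is non-increasing under extension of $\gamma$. *)

(* Defs.v *)
From HB Require Import structures.
From mathcomp Require Import all_boot all_order all_algebra.
From mathcomp Require Import all_classical all_reals all_analysis.

Set Implicit Arguments.
Unset Strict Implicit.
Unset Printing Implicit Defensive.

Import Order.TTheory GRing.Theory Num.Theory.
Import numFieldNormedType.Exports.

Local Open Scope classical_set_scope.
Local Open Scope ring_scope.

Record stationary_bratteli := Bratteli {
  vertex : finType;
  edge : finType;
  edge_source : edge -> vertex;
  edge_range : edge -> vertex }.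

Section Paths.
Variable B : stationary_bratteli.

Definition vlevel (n : nat) : finType :=
  if n is 0 then unit else vertex B.

(* An edge of level 0 is named by its range: there is exactly one edge from
   the root to each vertex of level 1. *)
Definition elevel (n : nat) : finType :=
  if n is 0 then vertex B else edge B.

Definition lsource (n : nat) : elevel n -> vlevel n :=
  match n with 0 => fun=> tt | _.+1 => @edge_source B end.

Definition lrange (n : nat) : elevel n -> vlevel n.+1 :=
  match n with 0 => id | _.+1 => @edge_range B end.

Arguments lsource n e : clear implicits.
Arguments lrange n e : clear implicits.

Record finpath := FinPath {
  plen : nat;
  pedge :> forall i : 'I_plen, elevel i;
  pedge_compat : forall (i : nat) (h : (i.+1 < plen)%N),
    lrange i (pedge (Ordinal (ltnW h))) = lsource i.+1 (pedge (Ordinal h)) }.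

Definition finprefix (g h : finpath) : Prop :=
  exists le_gh : (plen g <= plen h)%N,
    forall i : 'I_(plen g), g i = h (widen_ord le_gh i).

Definition edge_space : topologicalType :=
  prod_topology (fun n => discrete_topology (elevel n)).

(* Used through the coercion of a set to the type of its elements, which
   carries the topology induced by that of edge_space. *)
Definition ipaths : set edge_space :=
  [set x | forall n, lrange n (x n) = lsource n.+1 (x n.+1)].

Lemma ipathP (x : ipaths) (n : nat) :
  lrange n (set_val x n) = lsource n.+1 (set_val x n.+1).
Proof. by have := set_valP x; apply. Qed.

Definition iprefix (x : ipaths) (n : nat) : finpath :=
  @FinPath n (fun i => set_val x i) (fun i _ => ipathP x i).

Definition differ (x y : ipaths) (n : nat) : bool :=
  set_val x n != set_val y n :> elevel n.

(* The longest common prefix; the value at x = y is irrelevant. *)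
Definition path_meet (x y : ipaths) : finpath :=
  match pselect (exists n, differ x y n) with
  | left xy => iprefix x (ex_minn xy)
  | right _ => iprefix x 0
  end.

Definition prefix_of (g : finpath) (x : ipaths) : Prop :=
  forall i : 'I_(plen g), g i = set_val x i.

Lemma path_meetP (x y : ipaths) : x <> y ->
  [/\ prefix_of (path_meet x y) x, prefix_of (path_meet x y) y &
      forall g, prefix_of g x -> prefix_of g y ->
        (plen g <= plen (path_meet x y))%N].
Proof.
move=> xy; rewrite /path_meet; case: pselect => [h|nh]; last first.
  exfalso; apply/xy/val_inj/functional_extensionality_dep => n.
  by apply/eqP/negPn/negP => d; apply: nh; exists n.
case: ex_minnP => m dm min_m; split => //.
- move=> i /=; apply/eqP/negPn/negP => /(min_m i).
  by rewrite leqNgt ltn_ord.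
- move=> g gx gy /=; rewrite leqNgt; apply/negP => mg.
  by move/eqP: dm; apply; rewrite -(gx (Ordinal mg)) -(gy (Ordinal mg)).
Qed.

End Paths.

Arguments ipaths B : clear implicits.

Definition cantor_set (T : topologicalType) : Prop :=
  [/\ [set: T] !=set0, compact [set: T], totally_disconnected [set: T] &
      isolated [set: T] = set0].

Definition ultrametric (R : realType) (T : Type) (rho : T -> T -> R) : Prop :=
  [/\ forall x y, 0 <= rho x y,
      forall x y, rho x y = 0 <-> x = y,
      forall x y, rho x y = rho y x &
      forall x y z, rho x z <= Num.max (rho x y) (rho y z)].

Definition self_similar_weight (R : realType) (B : stationary_bratteli)
    (alpha : R) (a : finpath B -> R) : Prop :=
  [/\ 0 < alpha < 1,
      forall g, 0 < a g,
      (0 < ereal_inf [set (a g)%:E | g in [set: finpath B]])%E,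
      (ereal_sup [set (a g)%:E | g in [set: finpath B]] < +oo)%E &
      forall g h, finprefix g h ->
        a h * alpha ^+ plen h <= a g * alpha ^+ plen g].

Definition self_similar_ultrametric_cantor (R : realType) (B : stationary_bratteli)
    (rho : ipaths B -> ipaths B -> R) : Prop :=
  [/\ cantor_set (ipaths B : topologicalType),
      ultrametric rho &
      exists (alpha : R) (a : finpath B -> R),
        self_similar_weight alpha a /\
        forall x y, x <> y ->
          rho x y = a (path_meet x y) * alpha ^+ plen (path_meet x y)].

(* Main.v *)
(** Number the edges of each level by digits at most [K] and read the digits of
    a path as an expansion in base [1 / theta], where [theta = (2 K + 1)^-1].
    The tail after the first position [m] where two paths differ contributes
    at most half of [theta ^+ m], so the images of the two paths are at distance
    comparable to [theta ^+ m].  As [rho] is comparable to [alpha ^+ m], both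
    inequalities hold with exponent [ln theta / ln alpha]. *)

Require Import Defs.
From mathcomp Require Import all_boot all_order all_algebra.
From mathcomp Require Import all_classical all_reals all_analysis.
From mathcomp Require Import ring lra.
Local Open Scope ring_scope.

Import Order.TTheory GRing.Theory Num.Theory.

Section DigitExpansion.
Variables (R : realType) (K : nat).
Hypothesis K_gt0 : (0 < K)%N.

Definition ratio : R := (K%:R *+ 2 + 1)^-1.

Definition digit_sum (d : nat -> nat) (n : nat) : R :=
  \sum_(i < n) (d i)%:R * ratio ^+ i.

(** The terms are nonnegative, so for bounded digits this supremum is the sum of the series; the
    bounds on tails then come from bounds on partial sums, without limits. *)
Definition digit_value (d : nat -> nat) : R := sup (range (digit_sum d)).

Let K1 : 1 <= K%:R :> R. Proof. by rewrite ler1n. Qed.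

Lemma ratio_gt0 : 0 < ratio.
Proof. by rewrite invr_gt0; have := K1; lra. Qed.

Lemma ratio_lt1 : ratio < 1.
Proof. by rewrite invf_lt1; have := K1; lra. Qed.

Lemma ratioE : K%:R * ratio = (1 - ratio) / 2.
Proof. by rewrite /ratio; have := K1 => ?; field; apply/eqP; lra. Qed.

(** The constant [K + 1/2] is [K / (1 - ratio)], the value of the expansion with all digits equal to
    [K]. Shifted by one place, this largest tail weighs exactly one half. *)
Lemma tailE : (K%:R + 2^-1) * ratio = 2^-1.
Proof. by rewrite mulrDl ratioE; lra. Qed.

Variable d : nat -> nat.
Hypothesis d_le : forall i, (d i <= K)%N.

Lemma digit_sumS n : digit_sum d n.+1 = digit_sum d n + (d n)%:R * ratio ^+ n.
Proof. by rewrite /digit_sum big_ord_recr. Qed.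

Let pow_ge0 n : 0 <= ratio ^+ n.
Proof. by rewrite exprn_ge0 // ltW // ratio_gt0. Qed.

Lemma digit_sum_homo m n : (m <= n)%N -> digit_sum d m <= digit_sum d n.
Proof.
elim: n => [|n IH]; first by rewrite leqn0 => /eqP ->.
rewrite leq_eqVlt => /predU1P[-> //|/IH /le_trans]; apply.
by rewrite digit_sumS lerDl mulr_ge0.
Qed.

(** Each side completes a partial sum by the largest possible tail. Going one place further replaces
    a digit [K] of that tail by the actual digit, which is at most [K]. *)
Lemma digit_sum_upper_antitone m n : (m <= n)%N ->
  digit_sum d n + (K%:R + 2^-1) * ratio ^+ n
  <= digit_sum d m + (K%:R + 2^-1) * ratio ^+ m.
Proof.
elim: n => [|n IH]; first by rewrite leqn0 => /eqP ->.
rewrite leq_eqVlt => /predU1P[-> //|/IH /(le_trans _)]; apply.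
rewrite digit_sumS exprS mulrA tailE -addrA lerD2l -mulrDl.
by rewrite ler_wpM2r // lerD2r ler_nat.
Qed.

Lemma digit_sum_upper m n :
  digit_sum d n <= digit_sum d m + (K%:R + 2^-1) * ratio ^+ m.
Proof.
have tail_ge0 k : 0 <= (K%:R + 2^-1) * ratio ^+ k.
  by rewrite mulr_ge0 //; have := K1; lra.
case: (leqP m n) => [/digit_sum_upper_antitone|/ltnW/digit_sum_homo] h.
  by have := tail_ge0 n; lra.
by have := tail_ge0 m; lra.
Qed.

Lemma digit_sum_le_value n : digit_sum d n <= digit_value d.
Proof.
apply: ub_le_sup; last by exists n.
exists (digit_sum d 0 + (K%:R + 2^-1) * ratio ^+ 0) => _ [m _ <-].
exact: digit_sum_upper.
Qed.

Lemma digit_value_le n :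
  digit_value d <= digit_sum d n + (K%:R + 2^-1) * ratio ^+ n.
Proof.
apply: ge_sup; first by exists (digit_sum d 0), 0%N.
by move=> _ [m _ <-]; exact: digit_sum_upper.
Qed.

End DigitExpansion.

Lemma digit_value_dist (R : realType) (K m : nat) (d e : nat -> nat) :
  (0 < K)%N -> (forall i, d i <= K)%N -> (forall i, e i <= K)%N ->
  (forall i, (i < m)%N -> d i = e i) -> d m <> e m ->
  2^-1 * ratio R K ^+ m <= `|digit_value R K d - digit_value R K e|
    <= (K%:R + 2^-1) * ratio R K ^+ m.
Proof.
move=> K0; wlog lt_ed : d e / (e m < d m)%N => [hw dK eK de dme|dK eK de _].
  case: (ltngtP (d m) (e m)) => [lt_de|lt_ed|//]; last exact: hw.
  by rewrite distrC; apply: hw => // [i /de|/esym].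
have sumE : digit_sum R K d m = digit_sum R K e m.
  by apply: eq_bigr => i _; rewrite de.
(* The lower bound on the distance needs [dl] and [eu], which keep the digit at [m]; the upper bound
   needs only [du] and [el], cut before it. *)
have dl := digit_sum_le_value R K K0 d dK m.+1.
have du := digit_value_le R K K0 d dK m.
have el := digit_sum_le_value R K K0 e eK m.
have eu := digit_value_le R K K0 e eK m.+1.
rewrite digit_sumS in dl; rewrite digit_sumS exprS mulrA (tailE R K K0) in eu.
(* Digits are integers, so the gap at place [m] is a full [ratio ^+ m], of which the tail of [e] can
   cancel at most half. *)
have : (e m)%:R * ratio R K ^+ m + ratio R K ^+ m
       <= (d m)%:R * ratio R K ^+ m.
  rewrite -[X in _ + X]mul1r -mulrDl natr1.
  by rewrite ler_wpM2r ?ler_nat // exprn_ge0 // ltW // ratio_gt0.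
have p0 : 0 <= ratio R K ^+ m by rewrite exprn_ge0 ?ltW ?ratio_gt0.
move=> gap.
by rewrite ger0_norm; [apply/andP; split|]; lra.
Qed.

Lemma weight_bounds (R : realType) (B : stationary_bratteli) (alpha : R)
    (a : finpath B -> R) : self_similar_weight alpha a ->
  exists lo hi : R, [/\ 0 < lo, 0 < hi & forall g, lo <= a g <= hi].
Proof.
move=> [_ _ inf_gt0 sup_ltoo _].
have [lo lo0 lo_le] : exists2 lo : R, 0 < lo & forall g, lo <= a g.
  have inf_le g : (ereal_inf [set (a g)%:E | g in [set: finpath B]]
                   <= (a g)%:E)%E by apply: ereal_inf_lbound; exists g.
  move: inf_gt0 inf_le; case: ereal_inf => [r| |] //=.
    by rewrite lte_fin => r0 inf_le; exists r => // g; rewrite -lee_fin.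
  (* An infimum [+oo] cannot lie below a real weight, so the witness 1 is arbitrary. *)
  by move=> _ inf_le; exists 1 => // g; have := inf_le g.
have [hi hi_ge] : exists hi : R, forall g, a g <= hi.
  have sup_ge g : ((a g)%:E <=
      ereal_sup [set (a g)%:E | g in [set: finpath B]])%E.
    by apply: ereal_sup_ubound; exists g.
  move: sup_ltoo sup_ge; case: ereal_sup => [r| |] //=.
    by move=> _ sup_ge; exists r => g; rewrite -lee_fin.
  by move=> _ sup_ge; exists 1 => g; have := sup_ge g.
(* The maximum with 1 makes the upper bound positive without exhibiting a path. *)
exists lo, (Num.max hi 1); split=> // [|g]; first by rewrite lt_max ltr01 orbT.
by rewrite lo_le le_max hi_ge.
Qed.

Lemma path_meet_first_difference (B : stationary_bratteli) (x y : ipaths B) :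
  x <> y ->
  let m := plen (path_meet x y) in
  (forall i, (i < m)%N -> ~~ differ x y i) /\ differ x y m.
Proof.
move=> xy; rewrite /path_meet; case: pselect => [h|nh].
  case: ex_minnP => m dm min_m /=; split=> // i; rewrite ltnNge.
  exact/contraNN/min_m.
exfalso; apply/xy/val_inj/functional_extensionality_dep => n.
by apply/eqP/negPn/negP => d; apply: nh; exists n.
Qed.

Definition path_digit (B : stationary_bratteli) (x : ipaths B) (n : nat) : nat :=
  @enum_rank (elevel B n) (set_val x n).

(** Stationarity gives one bound for all levels: vertices count the edges of level 0, edges those of
    the others. The successor keeps the bound positive even for an empty diagram. *)
Lemma path_digit_le (B : stationary_bratteli) (x : ipaths B) (n : nat) :
  (path_digit B x n <= (#|vertex B| + #|edge B|).+1)%N.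
Proof.
have : (path_digit B x n < #|elevel B n|)%N by exact: ltn_ord.
move=> /ltnW/leq_trans; apply; apply: leqW.
by case: n => [|n] /=; [exact: leq_addr|exact: leq_addl].
Qed.

Lemma path_digit_eq (B : stationary_bratteli) (x y : ipaths B) (n : nat) :
  (path_digit B x n == path_digit B y n) = ~~ differ x y n.
Proof.
by rewrite /differ negbK -(inj_eq enum_rank_inj).
Qed.

Theorem theorem5p1 (R : realType) (B : stationary_bratteli)
    (rho : ipaths B -> ipaths B -> R)
    (h : self_similar_ultrametric_cantor rho) :
  exists (phi : ipaths B -> R) (c_minus c_plus a b : R),
    [/\ 0 < c_minus, 0 < c_plus, 0 < a & 0 < b] /\
    forall x y : ipaths B,
      c_minus * (rho x y `^ a) <= `|phi x - phi y| <= c_plus * (rho x y `^ b).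
Proof.
case: h => _ [_ rho0 _ _] [alpha [w [hw rhoE]]].
have [/andP[alpha0 alpha1] _ _ _ _] := hw.
have [lo [hi [lo0 hi0 w_bounds]]] := weight_bounds R B alpha w hw.
set K := (#|vertex B| + #|edge B|).+1.
pose th := ratio R K.
have K0 : (0 < K)%N by [].
have th0 : 0 < th := ratio_gt0 R K K0.
have th1 : th < 1 := ratio_lt1 R K K0.
have lnalpha0 : ln alpha < 0 by apply: ln_lt0; rewrite alpha0.
have lnth0 : ln th < 0 by apply: ln_lt0; rewrite th0.
pose t := ln th / ln alpha.
have t0 : 0 < t by rewrite nmulr_rgt0 // invr_lt0.
have alpha_t : alpha `^ t = th.
  by rewrite /powR gt_eqF // divfK ?lt_eqF // lnK.
have lot : 0 < lo `^ t by exact: powR_gt0.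
have hit : 0 < hi `^ t by exact: powR_gt0.
(* Since [alpha]^ t = th[, the power]rho x y [^ t] lies between [lo]^ t * th ^+ m[and]hi
   [^ t * th ^+ m], with [m] the length of the meet; the constants absorb these factors. *)
exists (fun x => digit_value R K (path_digit B x)), (2^-1 / hi `^ t),
  ((K%:R + 2^-1) / lo `^ t), t, t.
split; first by split=> //; rewrite divr_gt0 ?addr_gt0 ?invr_gt0 ?ltr0n.
move=> x y; have [->|xy] := pselect (x = y).
  (* Positivity of [t] matters here: zero to the power zero would be 1. *)
  by rewrite (rho0 y y).2 // powR0 ?gt_eqF // subrr normr0 !mulr0 lexx.
have [same diff] := path_meet_first_difference B x y xy.
rewrite rhoE //; set g := path_meet x y in same diff *.
have /andP[lo_le le_hi] := w_bounds g.
have w0 : 0 <= w g by exact: le_trans (ltW lo0) lo_le.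
have -> : (w g * alpha ^+ plen g) `^ t = w g `^ t * th ^+ plen g.
  rewrite powRM ?exprn_ge0 // ?ltW //; congr (_ * _).
  by rewrite -powR_mulrn ?ltW // -powRrM mulrC powRrM alpha_t powR_mulrn ?ltW.
have /andP[dist_ge dist_le] : 2^-1 * th ^+ plen g
    <= `|digit_value R K (path_digit B x) - digit_value R K (path_digit B y)|
    <= (K%:R + 2^-1) * th ^+ plen g.
  apply: digit_value_dist => //; try exact: path_digit_le.
    by move=> i /same; rewrite -path_digit_eq => /eqP.
  by apply/eqP; rewrite path_digit_eq diff.
have thn : 0 <= th ^+ plen g by rewrite exprn_ge0 ?ltW.
apply/andP; split.
  apply: le_trans dist_ge; rewrite -mulrA ler_wpM2l // mulrA ler_piMl //.
  by rewrite ler_pdivrMl // mulr1 ge0_ler_powR ?nnegrE // ltW.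
apply: le_trans dist_le _; rewrite -mulrA ler_wpM2l //.
rewrite mulrA ler_peMl // ler_pdivlMl // mulr1.
by rewrite ge0_ler_powR ?nnegrE // ltW.
Qed.
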